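(* Let $\Gamma$ be a (finite, simple, undirected) graph on $n\geq 2$ vertices with $e$ edges and let $A$ be its adjacency matrix. Then \[\mathrm{per}(J-2A-I)\equiv (-1)^n+\frac{n(1-(-1)^n)}{2}+4en \pmod 8.\]
   Context: $J$ denotes the $n\times n$ matrix with all entries $1$, $I$ the $n\times n$ identity matrix, and $\mathrm{per}(M)=\sum_{\sigma\in\mathfrak{S}_n}\prod_{i=1}^n M_{i,\sigma(i)}$ is the permanent of an $n\times n$ matrix $M$, where $\mathfrak{S}_n$ is the symmetric group on $n$ elements. *)

(* Defs.v *)
From mathcomp Require Import all_boot all_order all_algebra all_fingroup.

Set Implicit Arguments.
Unset Strict Implicit.
Unset Printing Implicit Defensive.

Import GRing.Theory.

Local Open Scope ring_scope.

Record sgraph (T : finType) := SGraph {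
  adj : rel T;
  adj_sym : symmetric adj;
  adj_irrefl : irreflexive adj
}.

(* An edge is the unordered pair of its endpoints, so each edge counts once. *)
Definition edges (T : finType) (G : sgraph T) : {set {set T}} :=
  [set [set p.1; p.2] | p : T * T & adj G p.1 p.2].

Definition adjmx (n : nat) (G : sgraph 'I_n) : 'M[int]_n :=
  \matrix_(i, j) (adj G i j)%:R.

Definition per (R : comNzRingType) (n : nat) (M : 'M[R]_n) : R :=
  \sum_(s : 'S_n) \prod_(i < n) M i (s i).

(* Main.v *)
Require Import Defs.
From mathcomp Require Import all_boot all_order all_algebra all_fingroup.
From mathcomp Require Import ring zify.

(** The matrix [S = J - 2A - I] is the Seidel matrix of the graph: it is
    symmetric, vanishes on the diagonal, and has entry [-1] at adjacent pairs
    and [1] at the other off-diagonal places.  The proof removes the edges one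
    at a time.

    Edgeless graph.  The permanent of [J - I] counts derangements, so it is the
    subfactorial [D_n] ([sum_derangements]).  The recurrence
    [D_(n+1) = (n+1) D_n + (-1)^(n+1)] gives [D_n = n - 1] for odd [n] and
    [D_n = 1] for even [n], modulo 8 ([subfactorial_mod8]): the step from odd
    to even is [n^2 - 1 = 0], the one from even to odd is immediate.

    One edge [ij].  Deleting it negates the entries at [(i, j)] and [(j, i)].
    A term of the permanent changes sign exactly when its permutation uses one
    of these two entries but not the other, and inversion exchanges the two
    cases because [S] is symmetric.  So the permanent changes by
    [4 * b], where [b] sums the terms with [s i = j] and [s j <> i]
    ([per_sign_flip]).  Only the parity of [b] matters modulo 8, and modulo 2
    the signs disappear: [b] has the parity of the number of derangements [s]
    with [s i = j] and [s j <> i].  Short-cutting the cycle [.. i j ..] of [s]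
    so that [j] becomes a fixed point puts these in bijection with the
    derangements of the other [n - 1] points ([sum_derangements_through]), and
    [D_(n-1)] has the parity of [n].  Hence every edge contributes [4n]
    modulo 8 ([per_delete_edge]). *)

Set Implicit Arguments.
Unset Strict Implicit.
Unset Printing Implicit Defensive.

Import GRing.Theory.

Local Open Scope ring_scope.

(** The number [D_n] of derangements of [n] points in its inclusion-exclusion
    form: the falling factorial [n ^_ (n - k)] is [n! / k!], that is,
    [C(n, k) * (n - k)!]. *)
Definition subfactorial (n : nat) : int :=
  \sum_(k < n.+1) (-1) ^+ k * (n ^_ (n - k))%:R.

Lemma subfactorial0 : subfactorial 0 = 1.
Proof. by rewrite /subfactorial big_ord1 expr0 mul1r. Qed.

Lemma subfactorialS (n : nat) :
  subfactorial n.+1 = n.+1%:R * subfactorial n + (-1) ^+ n.+1.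
Proof.
rewrite /subfactorial big_ord_recr /= subnn ffactn0 mulr1; congr (_ + _).
rewrite mulr_sumr; apply: eq_bigr => k _.
by rewrite subSn -1?ltnS // ffactSS natrM mulrCA.
Qed.

Lemma subfactorial_mod8 (n : nat) :
  exists z : int,
    subfactorial n = (if odd n then n%:Z - 1 else 1) + 8 * z.
Proof.
elim: n => [|n [z IHn]]; first by exists 0; rewrite subfactorial0.
rewrite subfactorialS IHn -signr_odd /=; case: (boolP (odd n)) => odd_n /=.
- have [m n_eq] : exists m, n = m.*2.+1 by exists n./2; lia.
  (* With n = 2m + 1, n.+1 * (n - 1) = 4 * m * m.+1, and m * m.+1 is even. *)
  have [t m_eq] : exists t, (m * m.+1 = t.*2)%N
    by exists (m * m.+1)./2; rewrite even_halfK // oddM /= andbN.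
  exists (t%:Z + n.+1%:R * z); rewrite expr0 n_eq; nia.
- by exists (n.+1%:R * z); rewrite expr1; lia.
Qed.

Lemma sum_subsets_by_card (T : finType) (V : nmodType) (A : {set T})
    (f : nat -> V) :
  \sum_(B : {set T} | B \subset A) f #|B| =
  \sum_(k < #|A|.+1) f k *+ 'C(#|A|, k).
Proof.
rewrite (partition_big (fun B : {set T} => inord #|B| : 'I_#|A|.+1) predT) //=.
apply: eq_bigr => k _; rewrite -cards_draws -sumr_const.
have inord_card (B : {set T}) : B \subset A ->
    (inord #|B| == k :> 'I_#|A|.+1) = (#|B| == k).
  by move=> sBA; rewrite -val_eqE /= inordK // ltnS subset_leq_card.
apply: eq_big => [B | B /andP[sBA]]; last by rewrite inord_card // => /eqP->.
by rewrite !inE; case: (boolP (B \subset A)) => //= /inord_card.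
Qed.

Lemma perm_on_setD (T : finType) (A B : {set T}) (s : {perm T}) :
  perm_on (A :\: B) s = perm_on A s && [forall x in B, s x == x].
Proof.
apply/subsetP/andP => [sAB | [/subsetP sA /forall_inP sB] x s_x].
  split; first by apply/subsetP=> x /sAB /setDP[].
  by apply/forall_inP=> x Bx; apply: contraLR Bx => /sAB /setDP[].
by rewrite inE sA // andbT; apply: contra s_x => /sB.
Qed.

(** Inclusion-exclusion over the set [B] of points required to be fixed.
    The statement is relative to a subset [A] because it is needed both for
    all points and for all points but one. *)
Lemma sum_derangements (T : finType) (A : {set T}) :
  \sum_(s : {perm T} | perm_on A s) \prod_(x in A) (s x != x)%:R =
  subfactorial #|A|.
Proof.
have expand (s : {perm T}) : \prod_(x in A) (s x != x)%:R =
    \sum_(B : {set T} | B \subset A)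
      (-1) ^+ #|B| * [forall x in B, s x == x]%:R :> int.
  rewrite big_mkcond /=.
  transitivity (\prod_x ((if x \in A then - (s x == x)%:R else 0) + 1) : int).
    by apply: eq_bigr => x _; case: ifP; case: (s x == x).
  rewrite bigA_distr [RHS]big_mkcond; apply: eq_bigr => B _.
  rewrite -big_mkcond /=; case: ifP => [sBA | /negbT/subsetPn[x Bx /negPf A'x]].
    rewrite (eq_bigr (fun x => - (s x == x)%:R)); last first.
      by move=> x /(subsetP sBA) ->.
    rewrite prodrN; congr (_ * _); case: forall_inP => [fixB | /forall_inP].
      by rewrite big1 // => x /fixB ->.
    by case/forall_inPn=> x Bx /negPf s_x; rewrite (bigD1 x) //= s_x mul0r.
  by rewrite (bigD1 x) //= A'x mul0r.
rewrite (eq_bigr _ (fun s _ => expand s)) exchange_big /=.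
transitivity (\sum_(B : {set T} | B \subset A)
                (-1) ^+ #|B| * (#|A| - #|B|)`!%:R : int).
  apply: eq_bigr => B sBA; rewrite -mulr_sumr; congr (_ * _).
  rewrite -[in RHS](setIidPr sBA) -cardsD -card_perm -sum1_card natr_sum.
  rewrite [LHS]big_mkcond [RHS]big_mkcond /=; apply: eq_bigr => s _.
  have -> : (s \in perm_on (A :\: B)) =
      perm_on A s && [forall x in B, s x == x].
    exact: perm_on_setD.
  by case: (perm_on A s); case: forall_inP.
rewrite (sum_subsets_by_card A (fun k => (-1) ^+ k * (#|A| - k)`!%:R)).
apply: eq_bigr => k _.
by rewrite -mulrnAr -mulrnA mulnC -bin_ffact bin_sub // -ltnS.
Qed.

(** Among the two entries [(i, j)] and [(j, i)], a permutation that uses both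
    or none keeps its term, and one that uses exactly one negates it, which
    costs twice the term.  The two ways of using exactly one contribute equally
    by [s |-> s^-1], as [M] is symmetric. *)
Lemma per_sign_flip (R : comNzRingType) (n : nat) (M N : 'M[R]_n)
    (i j : 'I_n) :
    i != j -> M^T = M ->
    (forall k l, N k l =
       if ((k == i) && (l == j)) || ((k == j) && (l == i))
       then - M k l else M k l) ->
  per N = per M
    - 4 * \sum_(s : 'S_n | (s i == j) && (s j != i)) \prod_k M k (s k).
Proof.
move=> neq_ij symM defN; have neq_ji : j != i by rewrite eq_sym.
pose w (s : 'S_n) := \prod_k M k (s k).
have wV s : w s^-1%g = w s.
  rewrite /w (reindex_inj (@perm_inj _ s)) /=; apply: eq_bigr => k _.
  by rewrite permK -[in LHS]symM mxE.
have prodN (s : 'S_n) : \prod_k N k (s k) = w s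
    - 2 * (if (s i == j) && (s j != i) then w s else 0)
    - 2 * (if (s j == i) && (s i != j) then w s else 0).
  rewrite /w (bigD1 i) // (bigD1 j) //= [\prod_k M k _](bigD1 i) //.
  rewrite [\prod_(k | k != i) M k _](bigD1 j) //=.
  rewrite (eq_bigr (fun k => M k (s k))); last first.
    by move=> k /andP[/negPf ki /negPf kj]; rewrite defN ki kj.
  rewrite !defN !eqxx (negPf neq_ij) (negPf neq_ji) /= orbF.
  by case: (s i == j); case: (s j == i) => /=; ring.
rewrite /per (eq_bigr _ (fun s _ => prodN s)) !sumrB -!mulr_sumr.
rewrite -!big_mkcond /=.
rewrite [X in _ - _ - 2 * X](reindex_inj invg_inj) /=.
rewrite [X in _ - _ - 2 * X](eq_bigl
  (fun s : 'S_n => (s i == j) && (s j != i))).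
  by rewrite [X in _ - _ - 2 * X](eq_bigr w) // -/w; ring.
move=> s; congr (_ && ~~ _).
  by rewrite eq_sym -(inj_eq (@perm_inj _ s)) permKV.
by rewrite eq_sym -(inj_eq (@perm_inj _ s)) permKV.
Qed.

(** Composing with the transposition of [i] and [j] turns [.. i j k ..] in the
    cycle of [s] into [.. i k ..] and fixes [j]; the condition [s j <> i] says
    that [i] is still moved afterwards. *)
Lemma sum_derangements_through (T : finType) (i j : T) : i != j ->
  \sum_(s : {perm T} | (s i == j) && (s j != i)) \prod_k (s k != k)%:R
  = subfactorial #|T|.-1.
Proof.
move=> neq_ij; have neq_ji : j != i by rewrite eq_sym.
rewrite (reindex_inj (mulgI (tperm i j))) /=.
have -> : #|T|.-1 = #|[set~ j]| by rewrite cardsC1.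
rewrite -sum_derangements [LHS]big_mkcond [RHS]big_mkcond /=.
apply: eq_bigr => t _; rewrite !permM tpermL tpermR.
have -> : perm_on [set~ j] t = (t j == j).
  apply/subsetP/eqP => [sub_t | t_j x]; last first.
    by rewrite !inE; apply: contraNneq => ->; rewrite t_j.
  by apply: contraTeq isT => /sub_t; rewrite !inE eqxx.
case: (eqVneq (t j) j) => //= tj.
rewrite [RHS](bigD1 i) ?inE //=; case: ifP => [ti | _]; last by rewrite mul0r.
rewrite mul1r (bigD1 i) //= (bigD1 j) //= !permM tpermL tpermR tj neq_ji.
have -> : t i != j by rewrite -[X in _ != X]tj (inj_eq perm_inj).
rewrite !mul1r; apply: eq_big => [k | k /andP[ki kj]].
  by rewrite !inE andbC.
by rewrite permM tpermD // eq_sym.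
Qed.

Definition seidel (n : nat) (G : sgraph 'I_n) : 'M[int]_n :=
  const_mx 1 - 2 *: adjmx G - 1%:M.

Lemma seidelE (n : nat) (G : sgraph 'I_n) (k l : 'I_n) :
  seidel G k l = 1 - 2 * (adj G k l)%:R - (k == l)%:R.
Proof. by rewrite !mxE. Qed.

Lemma seidel_sym (n : nat) (G : sgraph 'I_n) : (seidel G)^T = seidel G.
Proof. by apply/matrixP => k l; rewrite mxE !seidelE adj_sym eq_sym. Qed.

(** Modulo 2 the entries [1] and [-1] agree, so the Seidel matrix becomes
    [J - I] whatever the graph; the comparison takes place in ['F_2]. *)
Lemma seidel_sum_parity (n : nat) (G : sgraph 'I_n) (P : pred 'S_n) :
  exists z : int, \sum_(s | P s) \prod_k seidel G k (s k) =
    \sum_(s : 'S_n | P s) \prod_k (s k != k)%:R + 2 * z.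
Proof.
set a := \sum_(s | P s) \prod_k seidel G k (s k).
set b := \sum_(s : 'S_n | P s) \prod_k (s k != k)%:R.
suff /dvdzP[z ab] : (2 %| a - b)%Z by exists z; lia.
have F2 : 2%N \in [pchar 'F_2] by rewrite pchar_Fp.
rewrite (dvdz_pcharf F2) rmorphB /= subr_eq0 !rmorph_sum; apply/eqP.
apply: eq_bigr => s _; rewrite !rmorph_prod; apply: eq_bigr => k _ /=.
rewrite seidelE eq_sym; case: eqP => [->|_]; first by rewrite adj_irrefl.
by case: adj; apply/eqP.
Qed.

Definition delete_adj (T : finType) (G : sgraph T) (i j : T) : rel T :=
  fun k l =>
    adj G k l && ~~ (((k == i) && (l == j)) || ((k == j) && (l == i))).

Lemma delete_adj_sym (T : finType) (G : sgraph T) (i j : T) :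
  symmetric (delete_adj G i j).
Proof.
move=> k l; rewrite /delete_adj adj_sym orbC.
by rewrite [(k == j) && _]andbC [(k == i) && _]andbC.
Qed.

Lemma delete_adj_irrefl (T : finType) (G : sgraph T) (i j : T) :
  irreflexive (delete_adj G i j).
Proof. by move=> k; rewrite /delete_adj adj_irrefl. Qed.

Definition delete_edge (T : finType) (G : sgraph T) (i j : T) : sgraph T :=
  SGraph (delete_adj_sym G i j) (delete_adj_irrefl G i j).

Lemma edges_delete_edge (T : finType) (G : sgraph T) (i j : T) :
  edges (delete_edge G i j) = edges G :\ [set i; j].
Proof.
have eq_pair (k l : T) : ([set k; l] == [set i; j]) =
    ((k == i) && (l == j)) || ((k == j) && (l == i)).
  apply/eqP/idP => [eq_kl | /orP[]/andP[/eqP-> /eqP->] //]; last exact: setUC.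
  have: (k \in [set i; j]) && (l \in [set i; j]) by rewrite -eq_kl set21 set22.
  have: (i \in [set k; l]) && (j \in [set k; l]) by rewrite eq_kl set21 set22.
  rewrite !inE ![i == _]eq_sym ![j == _]eq_sym.
  by case: (k == i); case: (k == j); case: (l == i); case: (l == j).
apply/setP=> e; rewrite !inE; apply/imsetP/andP.
  case=> -[k l] /= /[!inE] /andP[Gkl Nkl ->]; rewrite eq_pair; split=> //.
  by apply/imsetP; exists (k, l); rewrite ?inE.
case=> Ne /imsetP[[k l] /= /[!inE] Gkl e_kl]; exists (k, l) => //=.
by rewrite inE /= /delete_adj Gkl -eq_pair -e_kl.
Qed.

(** The permanent changes by [4 * b], where [b] has the parity of
    [subfactorial n.-1], hence of [n]; the sign of this term is immaterial
    modulo 8. *)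
Lemma per_delete_edge (n : nat) (G : sgraph 'I_n) (i j : 'I_n) :
  adj G i j -> exists z : int,
    per (seidel G) = per (seidel (delete_edge G i j)) + 4 * n%:Z + 8 * z.
Proof.
move=> Gij; have neq_ij : i != j.
  by apply: contraTneq Gij => ->; rewrite adj_irrefl.
rewrite (per_sign_flip neq_ij (seidel_sym (delete_edge G i j))).
  have [z ->] := seidel_sum_parity (delete_edge G i j)
    (fun s => (s i == j) && (s j != i)).
  rewrite sum_derangements_through // card_ord.
  case: n i j G {Gij neq_ij} z => [[//] | n] i j G z /=.
  have [y ->] := subfactorial_mod8 n.
  case: (boolP (odd n)) => odd_n; last first.
    by exists (- n./2%:Z - 1 - z - 4 * y); lia.
  by exists (- n%:Z - z - 4 * y); lia.
move=> k l; rewrite !seidelE /= /delete_adj.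
case: ifP => [kl | ->]; last by rewrite andbT.
rewrite kl andbF.
by case/orP: kl => /andP[/eqP-> /eqP->];
  rewrite ?[adj G j i]adj_sym Gij ?[j == i]eq_sym (negPf neq_ij).
Qed.

Lemma per_seidel_mod8 (n : nat) (G : sgraph 'I_n) :
  exists z : int, per (seidel G) =
    subfactorial n + 4 * #|edges G|%:Z * n%:Z + 8 * z.
Proof.
have [m] := ubnP #|edges G|; elim: m G => // m IHm G le_m.
have [G0 | [e]] := set_0Vmem (edges G).
  have adj0 k l : adj G k l = false.
    apply/negP=> Gkl; suff: [set k; l] \in edges G by rewrite G0 inE.
    by apply/imsetP; exists (k, l); rewrite ?inE.
  exists 0; rewrite G0 cards0 mulr0 mul0r !addr0 -[n in subfactorial n]card_ord.
  rewrite -cardsT -sum_derangements; apply: eq_big => [s | s _].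
    by rewrite /perm_on; apply/esym/subsetP=> x; rewrite inE.
  apply: eq_big => [k | k _]; first by rewrite inE.
  by rewrite seidelE adj0 eq_sym; case: eqP.
move=> Ge; have /imsetP[[i j] /= /[!inE] Gij e_ij] := Ge.
have := cardsD1 e (edges G); rewrite Ge e_ij -edges_delete_edge => cardG.
have [|z IHG] := IHm (delete_edge G i j); first by lia.
have [y ->] := per_delete_edge Gij; exists (z + y).
by rewrite IHG cardG; lia.
Qed.

Theorem theorem3p7 (n : nat) (hn : (2 <= n)%N) (G : sgraph 'I_n) :
  (per (const_mx 1%R - 2 *: adjmx G - 1%:M)
   = (-1) ^+ n + (n%:Z * (1 - (-1) ^+ n) %/ 2)%Z + 4 * #|edges G|%:Z * n%:Z
   %[mod 8])%Z.
Proof.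
have [z perG] := per_seidel_mod8 G; have [y subn_eq] := subfactorial_mod8 n.
rewrite -/(seidel G) perG subn_eq -signr_odd.
by case: (odd n); rewrite ?expr0 ?expr1; lia.
Qed.
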